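(* The hyperbolic covers $(\tilde W,\tilde S)$ and $(\hat W,\hat S)$ of a tubular elliptic Weyl system $(W,S)$ are isomorphic, i.e. there is a group isomorphism $\tilde W\to\hat W$ mapping $\tilde S$ bijectively onto $\hat S$.
   Context: Root systems. Let $V$ be a finite-dimensional real vector space with a symmetric bilinear form $(-\mid-)$ with radical $R$. For a vector $\alpha$ with $(\alpha\mid\alpha)\ne0$ put $s_\alpha(v)=v-\frac{2(\alpha\mid v)}{(\alpha\mid\alpha)}\alpha$. A generalized root system is a non-empty set $\Phi\subseteq V$ of non-isotropic vectors with $\mathrm{span}_{\mathbb R}(\Phi)=V$, $s_\alpha(\Phi)\subseteq\Phi$ for all $\alpha\in\Phi$, and $\frac{2(\alpha\mid\beta)}{(\beta\mid\beta)}\in\mathbb Z$ for all $\alpha,\beta\in\Phi$; its root lattice $L(\Phi)=\mathrm{span}_{\mathbb Z}(\Phi)$ is a lattice in $V$ (generated by an $\mathbb R$-basis of $V$). It is reduced if $r\alpha\in\Phi$ ($\alpha\in\Phi$, $r\in\mathbb R$) implies $r=\pm1$, and irreducible if it is not a union of two mutually orthogonal generalized root systems. It is elliptic if it is irreducible and reduced and $(-\mid-)$ has signature $(n,0,2)$ (numbers of positive, negative, zero eigenvalues), $n+2=\dim V$. Standing assumption: $(\alpha\mid\alpha)=2$ for all $\alpha\in\Phi$. Choices. Fix a $1$-dimensional subspace $U\le R$ with $U\cap L(\Phi)\ne\{0\}$ and $a$ with $L(\Phi)\cap U=\mathbb Za$. The image $\Phi/U$ of $\Phi$ in $V/U$ is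 an irreducible affine root system; let $\beta_0,\dots,\beta_n$ be a root basis (simple system) of it such that $\beta_1,\dots,\beta_n$ is a root basis of a finite root system ($\beta_0$ being the affine node in the standard numbering), and let $m_1,\dots,m_n$ be the unique positive integers such that $\beta_0+\sum_{i=1}^n m_i\beta_i$ spans $L(\Phi/U)\cap R/U$; put $m_0=1$. Choose preimages $\alpha_i\in\Phi$ of $\beta_i$ and put $b=\sum_{i=0}^n m_i\alpha_i\in R$, $V_{\mathrm{fin}}=\sum_{i=1}^n\mathbb R\alpha_i$. Tubular case. $\Phi$ is tubular if exactly one index $t$ satisfies $m_t=\max_i m_i$; then put $\alpha_{t^\star}=\alpha_t+a$, $M=\{0,\dots,n,t^\star\}$, $s_i=s_{\alpha_i}$, $S=\{s_i\mid i\in M\}$ and $W=\langle s_\alpha\mid\alpha\in\Phi\rangle\le \mathrm{GL}(V)$; $(W,S)$ is called a tubular elliptic Weyl system. Hyperbolic covers. Let $\hat V\supseteq V$ be the space with non-degenerate form of signature $(n+2,2,0)$ extending that of $V$, $\hat V=V_{\mathrm{fin}}\perp\langle a,a'\rangle\perp\langle b,b'\rangle$ with $(a,a'),(b,b')$ hyperbolic pairs (isotropic vectors with product $1$), and let $\tilde V=V\oplus\mathbb Rb'\subset\hat V$. For $i\in M$ let $\tilde s_i$ and $\hat s_i$ be the reflections of $\tilde V$ and of $\hat V$ with respect to $\alpha_i$; $\tilde S=\{\tilde s_i\mid i\in M\}$, $\tilde W=\langle\tilde S\rangle$, $\hat S=\{\hat s_i\mid i\in M\}$, $\hat W=\langle\hat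 S\rangle$. *)

(* Defs.v *)
From HB Require Import structures.
From mathcomp Require Import all_boot all_order all_algebra.
From mathcomp Require Import boolp classical_sets functions cardinality reals.

Set Implicit Arguments.
Unset Strict Implicit.
Unset Printing Implicit Defensive.

Import Order.TTheory GRing.Theory Num.Theory.

Local Open Scope classical_set_scope.
Local Open Scope ring_scope.

Section Forms.
Context {R : realType} {V : vectType R}.

Definition gram (B : V -> V -> R) (k : nat) (X : k.-tuple V) : 'M[R]_k :=
  \matrix_(i, j) B X`_i X`_j.

(* [s] lists the eigenvalues of the Gram matrix with multiplicity. By
   Sylvester's law of inertia the basis [X] does not matter. *)
Definition has_signature (B : V -> V -> R) (pos neg zero : nat) : Prop :=
  exists2 X : (\dim {:V}).-tuple V, basis_of fullv X &
  exists2 s : seq R, char_poly (gram B X) = \prod_(x <- s) ('X - x%:P) &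
  [/\ count (fun x => 0 < x) s = pos,
      count (fun x => x < 0) s = neg &
      count (fun x => x == 0) s = zero].

Definition refl_fun (B : V -> V -> R) (alpha v : V) : V :=
  v - (2 * B alpha v / B alpha alpha) *: alpha.

Definition reflection (B : V -> V -> R) (alpha : V) : 'End(V) :=
  linfun (refl_fun B alpha).

Definition Rspan (A : set V) : set V :=
  [set v | exists (k : nat) (x : 'I_k -> V) (c : 'I_k -> R),
     (forall i, A (x i)) /\ v = \sum_(i < k) c i *: x i].

Definition Zspan (A : set V) : set V :=
  [set v | exists (k : nat) (x : 'I_k -> V) (c : 'I_k -> int),
     (forall i, A (x i)) /\ v = \sum_(i < k) x i *~ c i].

End Forms.

Section RootSystems.
Context {R : realType} {V : vectType R}.
Implicit Types (B : {symmetric V}) (E : {vspace V}) (Phi : set V).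

(* Generalized root systems are taken inside a subspace [E] of the ambient
   space (which they must span), so that subsystems make sense without
   changing the ambient type. *)
Record generalized_root_system B E Phi : Prop := {
  grs_nonempty : Phi !=set0;
  grs_nonisotropic : forall x, Phi x -> B x x != 0;
  grs_span : Rspan Phi = [set x | x \in E];
  grs_refl : forall x y, Phi x -> Phi y -> Phi (reflection B x y);
  grs_int : forall x y, Phi x -> Phi y -> 2 * B x y / B y y \is a Num.int;
  grs_lattice : exists2 X : (\dim E).-tuple V, basis_of E X &
                  Zspan Phi = Zspan [set x | x \in (X : seq V)]
}.

Definition reduced Phi : Prop :=
  forall (x : V) (r : R), Phi x -> Phi (r *: x) -> r = 1 \/ r = -1.

Definition irreducible B Phi : Prop :=
  ~ exists (Phi1 Phi2 : set V) (E1 E2 : {vspace V}),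
      [/\ generalized_root_system B E1 Phi1,
          generalized_root_system B E2 Phi2,
          (forall x y, Phi1 x -> Phi2 y -> B x y = 0) &
          Phi = Phi1 `|` Phi2].

Record elliptic B Phi (n : nat) : Prop := {
  elliptic_grs : generalized_root_system B fullv Phi;
  elliptic_irreducible : irreducible B Phi;
  elliptic_reduced : reduced Phi;
  elliptic_signature : has_signature B n 0 2;
  elliptic_dim : (n + 2)%N = \dim {:V}
}.

Definition root_basis (Phi : set V) (k : nat) (beta : 'I_k -> V) : Prop :=
  [/\ free [seq beta i | i <- enum 'I_k],
      (forall i, Phi (beta i)) &
      (forall x, Phi x -> exists c : 'I_k -> nat,
         x = \sum_(i < k) beta i *+ c i \/ x = - \sum_(i < k) beta i *+ c i)].

Definition finite_root_system B E Phi : Prop :=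
  generalized_root_system B E Phi /\ finite_set Phi.

End RootSystems.

Section LinearGroups.
Context {R : realType} {V : vectType R}.

Definition linear_group (G : set 'End(V)) : Prop :=
  [/\ G \1%VF,
      (forall f g, G f -> G g -> G (f \o g)%VF) &
      (forall f, G f -> lker f == 0%VS /\ G (f^-1)%VF)].

Definition generated_group (S : set 'End(V)) : set 'End(V) :=
  smallest linear_group S.

End LinearGroups.

Definition isomorphic_systems {R : realType} {V1 V2 : vectType R}
    (W1 S1 : set 'End(V1)) (W2 S2 : set 'End(V2)) : Prop :=
  exists phi : 'End(V1) -> 'End(V2),
    [/\ set_bij W1 W2 phi,
        (forall f g, W1 f -> W1 g -> phi (f \o g)%VF = (phi f \o phi g)%VF) &
        set_bij S1 S2 phi].

Section Tubular.
Context {R : realType} {V : vectType R}.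

(* [pi : V -> Vq] is any model of the quotient map [V -> V / U], and [Bq] is
   the form induced on it. *)
Record quotient_by (B : {symmetric V}) (U : {vspace V})
    (Vq : vectType R) (pi : 'Hom(V, Vq)) (Bq : {symmetric Vq}) : Prop := {
  quotient_ker : lker pi = U;
  quotient_surj : limg pi = fullv;
  quotient_form : forall x y, Bq (pi x) (pi y) = B x y
}.

(* The index [ord0] is the affine node, [lift ord0 i] runs through 1, .., n.
   That it is the affine node is expressed by its mark being 1, up to a
   diagram automorphism. *)
Record affine_basis_choice (B : {symmetric V}) (Phi : set V) (n : nat)
    (U : {vspace V}) (a : V)
    (Vq : vectType R) (pi : 'Hom(V, Vq)) (Bq : {symmetric Vq})
    (beta : 'I_n.+1 -> Vq) (m : 'I_n.+1 -> nat) (alpha : 'I_n.+1 -> V) :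
    Prop := {
  choice_U_dim : \dim U = 1%N;
  choice_U_rad : (U <= orthov B fullv)%VS;
  choice_U_lattice : exists u, [/\ u \in U, Zspan Phi u & u != 0];
  choice_a : Zspan Phi `&` [set u | u \in U] = Zspan [set a];
  choice_quotient : quotient_by B U pi Bq;
  choice_beta : root_basis (pi @` Phi) beta;
  choice_beta_fin : exists2 Psi : set Vq,
    finite_root_system Bq <<[seq beta (lift ord0 i) | i <- enum 'I_n]>>%VS Psi &
    root_basis Psi (fun i : 'I_n => beta (lift ord0 i));
  choice_m0 : m ord0 = 1%N;
  choice_m_pos : forall i, (0 < m i)%N;
  choice_m : Zspan (pi @` Phi) `&` [set x | x \in (pi @: orthov B fullv)%VS]
             = Zspan [set \sum_(i < n.+1) beta i *+ m i];
  choice_alpha : forall i, Phi (alpha i);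
  choice_alpha_beta : forall i, pi (alpha i) = beta i
}.

Definition tubular (n : nat) (m : 'I_n.+1 -> nat) (t : 'I_n.+1) : Prop :=
  unique (fun i => m i = \max_(j < n.+1) m j) t.

Section Generators.
Context {n : nat} (alpha : 'I_n.+1 -> V) (m : 'I_n.+1 -> nat).
Context (a : V) (t : 'I_n.+1).

(* The index set M = {0, .., n, t*} is [option 'I_n.+1], with [None] as t*. *)
Definition extended_root (i : option 'I_n.+1) : V :=
  if i is Some j then alpha j else alpha t + a.

Definition null_root : V := \sum_(i < n.+1) alpha i *+ m i.

Definition Vfin : {vspace V} :=
  <<[seq alpha (lift ord0 i) | i <- enum 'I_n]>>%VS.

Definition tubular_elliptic_Weyl_system (B : {symmetric V}) (Phi : set V)
    (W S : set 'End(V)) : Prop :=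
  W = generated_group [set reflection B x | x in Phi] /\
  S = range (fun i => reflection B (extended_root i)).

(* [iota] is the inclusion of [V] in the hyperbolic extension [Vh]. *)
Record hyperbolic_extension (B : {symmetric V}) (Vh : vectType R)
    (iota : 'Hom(V, Vh)) (Bh : {symmetric Vh}) (a' b' : Vh) : Prop := {
  hyp_inj : lker iota = 0%VS;
  hyp_isometry : forall x y, Bh (iota x) (iota y) = B x y;
  hyp_nondegenerate : nondegenerate Bh;
  hyp_signature : has_signature Bh (n + 2) 2 0;
  hyp_full : (iota @: Vfin + <<[:: iota a; a']>> +
              <<[:: iota null_root; b']>>)%VS = fullv;
  hyp_direct : directv (iota @: Vfin + <<[:: iota a; a']>> +
                        <<[:: iota null_root; b']>>)%VS;
  hyp_orth_a : (iota @: Vfin <= orthov Bh <<[:: iota a; a']>>)%VS;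
  hyp_orth_b : (iota @: Vfin <= orthov Bh <<[:: iota null_root; b']>>)%VS;
  hyp_orth_ab : (<<[:: iota a; a']>> <=
                 orthov Bh <<[:: iota null_root; b']>>)%VS;
  hyp_pair_a : [/\ Bh (iota a) (iota a) = 0, Bh a' a' = 0 &
                   Bh (iota a) a' = 1];
  hyp_pair_b : [/\ Bh (iota null_root) (iota null_root) = 0, Bh b' b' = 0 &
                   Bh (iota null_root) b' = 1]
}.

Section Covers.
Context {Vh : vectType R} (iota : 'Hom(V, Vh)) (Bh : {symmetric Vh}) (b' : Vh).

Definition Vtilde : {vspace Vh} := (limg iota + <[b']>)%VS.

Definition Btilde (x y : subvs_of Vtilde) : R := Bh (vsval x) (vsval y).

Definition Stilde : set 'End(subvs_of Vtilde) :=
  range (fun i => reflection Btilde (vsproj Vtilde (iota (extended_root i)))).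

Definition Wtilde : set 'End(subvs_of Vtilde) := generated_group Stilde.

Definition Shat : set 'End(Vh) :=
  range (fun i => reflection Bh (iota (extended_root i))).

Definition What : set 'End(Vh) := generated_group Shat.

End Covers.
End Generators.
End Tubular.

Arguments Stilde {R V n} alpha a t {Vh} iota Bh b' _.
Arguments Wtilde {R V n} alpha a t {Vh} iota Bh b' _.

(* Main.v *)
From HB Require Import structures.
Require Import Defs.
From mathcomp Require Import all_boot all_order all_algebra.
From mathcomp Require Import boolp classical_sets functions cardinality reals.
From mathcomp Require Import ring lra.

(** The group [What] is generated by reflections in vectors of [V], so it
    stabilizes the hyperplane [Vtilde = V + R b'] of the hyperbolic extension,
    and restricting to that hyperplane sends each generator of [What] to the
    corresponding generator of [Wtilde]. Restriction is therefore an
    epimorphism from [What] onto [Wtilde] ([generated_group_image]), and the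
    whole content of the statement is that its kernel is trivial.

    The kernel is trivial because [Vtilde] is a degenerate hyperplane: the
    vector [a] lies in [Vtilde] and is orthogonal to it. Let [w] be an isometry
    fixing [Vtilde] pointwise. The vector [w a' - a'] is orthogonal to
    [Vtilde], whence [w a' = a' + c a] for some scalar [c] by nondegeneracy.
    Comparing the squared lengths of [w a'] and [a'] gives [2 c = 0], so [w]
    also fixes [a'], which together with [Vtilde] spans the space
    ([isometry_fixing_degenerate_hyperplane]). The isomorphism
    [Wtilde -> What] is the inverse of restriction. *)

Set Implicit Arguments.
Unset Strict Implicit.
Unset Printing Implicit Defensive.

Import GRing.Theory.

Local Open Scope classical_set_scope.
Local Open Scope ring_scope.

(** * Linear groups and their images *)

Section GeneratedGroups.
Context {R : realType} {V : vectType R}.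

(** Without a linear group above [S] the conclusion fails: if [S] contains a
    non-invertible map, then [generated_group S] is an empty intersection,
    hence the set of all endomorphisms. *)
Lemma linear_group_generated (H S : set 'End(V)) :
  linear_group H -> S `<=` H -> linear_group (generated_group S).
Proof.
move=> gH sSH; split.
- by move=> G /= [[]].
- move=> f g Gf Gg G G_S; have [[_ GM _] _] := G_S.
  by apply: GM; [exact: (Gf G G_S) | exact: (Gg G G_S)].
- move=> f Gf; split; first by have [_ _ /(_ f (Gf H (conj gH sSH)))[]] := gH.
  move=> G G_S; have [[_ _ GV] _] := G_S.
  by have [] := GV f (Gf G G_S).
Qed.

End GeneratedGroups.

Section Images.
Context {R : realType} {V V' : vectType R} (psi : 'End(V) -> 'End(V')).
Implicit Types H S : set 'End(V).

(** Multiplicativity on [H] forces [psi (f^-1)] to be a left inverse of [psi f],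
    and in finite dimension this makes [psi f] invertible. *)
Lemma linear_group_image H :
    linear_group H -> psi \1%VF = \1%VF ->
    (forall f g, H f -> H g -> psi (f \o g)%VF = (psi f \o psi g)%VF) ->
  linear_group (psi @` H) /\
  (forall f, H f -> psi (f^-1)%VF = ((psi f)^-1)%VF).
Proof.
move=> [H1 HM HV] psi1 psiM.
have psiK f : H f -> lker (psi f) == 0%VS /\ psi (f^-1)%VF = ((psi f)^-1)%VF.
  move=> Hf; have [kf HVf] := HV f Hf.
  have psiVf : (psi (f^-1) \o psi f = \1)%VF.
    by rewrite -psiM // lker0_compVf.
  have kpsi : lker (psi f) == 0%VS.
    by apply/lker0P; apply: (can_inj (g := psi (f^-1)%VF)) => v;
       rewrite -comp_lfunE psiVf id_lfunE.
  by split=> //; rewrite -[RHS]comp_lfun1l -psiVf lker0_compfK.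
split; last by move=> f /psiK[].
split; first by exists \1%VF.
- by move=> _ _ [f Hf <-] [g Hg <-]; exists (f \o g)%VF; [exact: HM|exact: psiM].
- move=> _ [f Hf <-]; have [kpsi psiV] := psiK f Hf; split=> //.
  by exists (f^-1)%VF => //; have [] := HV f Hf.
Qed.

(** The generated group is only known as an intersection, so both inclusions are
    instances of minimality: [psi @` generated_group S] is a linear group
    containing [psi @` S], and the elements of [H] that [psi] sends into
    [generated_group (psi @` S)] form a linear group containing [S]. *)
Lemma generated_group_image H S :
    linear_group H -> S `<=` H -> psi \1%VF = \1%VF ->
    (forall f g, H f -> H g -> psi (f \o g)%VF = (psi f \o psi g)%VF) ->
  generated_group (psi @` S) = psi @` generated_group S.
Proof.
move=> gH sSH psi1 psiM.
have gG := linear_group_generated gH sSH.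
have sGH : generated_group S `<=` H by exact: smallest_sub.
have [gpH psiV] := linear_group_image gH psi1 psiM.
have [G1' GM' GV'] : linear_group (generated_group (psi @` S)).
  by apply: (linear_group_generated gpH); exact: image_subset.
apply/seteqP; split.
  apply: smallest_sub; last by apply: image_subset; exact: sub_gen_smallest.
  by have [] := linear_group_image gG psi1
                  (fun f g Gf Gg => psiM f g (sGH f Gf) (sGH g Gg)).
suff sG : generated_group S `<=`
    [set f | H f /\ generated_group (psi @` S) (psi f)].
  by move=> _ [f /sG[_ Gpsi] <-].
have [H1 HM HV] := gH.
apply: smallest_sub; last first.
  by move=> f Sf; split; [exact: sSH | apply: sub_gen_smallest; exists f].
split=> /=; first by rewrite psi1.
- move=> f g [Hf Gf] [Hg Gg]; split; first exact: HM.
  by rewrite psiM //; exact: GM'.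
- move=> f [Hf Gf]; have [kf HVf] := HV f Hf; split=> //; split=> //.
  by rewrite psiV //; have [] := GV' _ Gf.
Qed.

(** Injectivity is asked on [H] because all that is known about the elements of
    the generated group is that they belong to [H]. The isomorphism is the
    partial inverse of [psi] on [H]. *)
Lemma isomorphic_systems_image H S :
    linear_group H -> S `<=` H -> psi \1%VF = \1%VF ->
    (forall f g, H f -> H g -> psi (f \o g)%VF = (psi f \o psi g)%VF) ->
    {in H &, injective psi} ->
  isomorphic_systems (generated_group (psi @` S)) (psi @` S)
                     (generated_group S) S.
Proof.
move=> gH sSH psi1 psiM psiI.
rewrite (generated_group_image gH sSH psi1 psiM).
have sGH : generated_group S `<=` H by exact: smallest_sub.
have [_ GM _] := linear_group_generated gH sSH.
pose phi := pinv_ (fun=> 0) H psi.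
have phiK f : H f -> phi (psi f) = f.
  by move=> Hf; apply: pinvKV => //; rewrite inE.
have phi_bij A : A `<=` H -> set_bij (psi @` A) A phi.
  move=> sAH; split.
  - by move=> _ [f Af <-]; rewrite phiK //; exact: sAH.
  - move=> x y /set_mem[f Af <-] /set_mem[g Ag <-].
    by rewrite !phiK; [move=> -> | exact: sAH | exact: sAH].
  - by move=> f Af; exists (psi f); [exists f | rewrite phiK //; exact: sAH].
exists phi; split; [exact: phi_bij | | exact: phi_bij].
move=> _ _ [f Gf <-] [g Gg <-].
have [Hf Hg] : H f /\ H g by split; exact: sGH.
rewrite -psiM // !phiK //; by apply: sGH; exact: GM.
Qed.

End Images.

(** * Reflections *)

Section Reflections.
Context {R : realType} {V : vectType R}.

Lemma reflectionE (B : V -> V -> R) x v :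
  scalar (B x) -> reflection B x v = refl_fun B x v.
Proof.
move=> linB; have lin : linear (refl_fun B x).
  move=> k u w; rewrite /refl_fun linB mulrDr mulrDl scalerDl scalerBr scalerA.
  by rewrite addrACA opprD; congr (_ + _ + (- (_ *: _) - _)); ring.
pose L : {linear V -> V} :=
  HB.pack (refl_fun B x) (GRing.isLinear.Build _ _ _ _ _ lin).
exact: (lfunE L).
Qed.

Variable B : {symmetric V}.

Lemma symmetricC u v : B u v = B v u.
Proof. by rewrite hermC expr0 mul1r. Qed.

Lemma symmetric_reflectionE x v : reflection B x v = refl_fun B x v.
Proof. by apply: reflectionE => k u w; rewrite linearPr. Qed.

(** Division by zero makes the reflection in an isotropic vector the identity,
    which is the degenerate case in the next two proofs. *)
Lemma reflection_isometry x u v :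
  B (reflection B x u) (reflection B x v) = B u v.
Proof.
rewrite !symmetric_reflectionE /refl_fun linearBl !linearBr !linearZl_LR.
rewrite !linearZr_LR /= (symmetricC u x).
have [->|nx] := eqVneq (B x x) 0; first by rewrite invr0; ring.
by field.
Qed.

Lemma reflectionK x : involutive (reflection B x).
Proof.
move=> v; rewrite !symmetric_reflectionE /refl_fun linearBr linearZr_LR /=.
rewrite -addrA -opprD -scalerDl.
suff -> : 2 * B x v / B x x +
          2 * (B x v - 2 * B x v / B x x * B x x) / B x x = 0.
  by rewrite scale0r subr0.
have [->|nx] := eqVneq (B x x) 0; first by rewrite invr0; ring.
by field.
Qed.

End Reflections.

(** * Isometries stabilizing a subspace *)

Section Restriction.
Context {R : realType} {V : vectType R} (B : {symmetric V}) (E : {vspace V}).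

Definition stabilizing_isometries : set 'End(V) :=
  [set f : 'End(V) | [/\ forall u v, B (f u) (f v) = B u v,
               (f @: E <= E)%VS & lker f == 0%VS]].

Lemma linear_group_stabilizing_isometries :
  linear_group stabilizing_isometries.
Proof.
split.
- split; first by move=> u v; rewrite !id_lfunE.
  + by rewrite lim1g.
  + by apply/lker0P => u v; rewrite !id_lfunE.
- move=> f g [fB fE /lker0P kf] [gB gE /lker0P kg]; split.
  + by move=> u v; rewrite !comp_lfunE fB gB.
  + by rewrite limg_comp (subv_trans (limgS _ gE)).
  + by apply/lker0P => u v; rewrite !comp_lfunE => /kf/kg.
- move=> f [fB fE kf]; split=> //; split.
  + by move=> u v; rewrite -fB !lker0_lfunVK.
  + (* The inclusion [f E <= E] is an equality, by dimension. *)
    have fEE : (f @: E)%VS = E.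
      apply/eqP; rewrite eqEdim fE /=.
      by rewrite (limg_dim_eq (f := f)) // (eqP kf) capv0.
    by rewrite -{1}fEE -limg_comp lker0_compVf // lim1g.
  + apply/lker0P; exact: can_inj (lker0_lfunVK kf).
Qed.

Lemma reflection_stabilizing x :
  x \in E -> stabilizing_isometries (reflection B x).
Proof.
move=> xE; split; first exact: reflection_isometry.
- apply/subvP => _ /memv_imgP[v vE ->]; rewrite symmetric_reflectionE.
  by rewrite rpredB ?rpredZ.
- exact/lker0P/inv_inj/reflectionK.
Qed.

Definition restriction (f : 'End(V)) : 'End(subvs_of E) :=
  (linfun (vsproj E) \o f \o linfun vsval)%VF.

Lemma restrictionE f v : (f @: E <= E)%VS ->
  vsval (restriction f v) = f (vsval v).
Proof.
move=> /subvP fE; rewrite !comp_lfunE !lfunE /= vsprojK //.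
by apply/fE/memv_img/subvsP.
Qed.

Lemma restriction1 : restriction \1%VF = \1%VF.
Proof.
by apply/lfunP => v; apply: subvs_inj; rewrite restrictionE ?lim1g // !id_lfunE.
Qed.

Lemma restrictionM f g : stabilizing_isometries f -> stabilizing_isometries g ->
  restriction (f \o g)%VF = (restriction f \o restriction g)%VF.
Proof.
move=> [_ fE _] [_ gE _]; apply/lfunP => v; apply: subvs_inj.
rewrite restrictionE ?limg_comp ?(subv_trans (limgS _ gE)) //.
by rewrite 2!comp_lfunE !restrictionE.
Qed.

Lemma restriction_reflection x : x \in E ->
  restriction (reflection B x) =
  reflection (fun u v : subvs_of E => B (vsval u) (vsval v)) (vsproj E x).
Proof.
move=> xE; have [_ rE _] := reflection_stabilizing xE.
apply/lfunP => v; apply: subvs_inj; rewrite restrictionE //.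
rewrite symmetric_reflectionE reflectionE; last first.
  by move=> k u w; rewrite [vsval (_ + _)]linearP linearPr.
by rewrite /refl_fun [RHS]linearB [in RHS]linearZ /= vsprojK // scalerN.
Qed.

(** The orthogonal space of [E] is the line spanned by the isotropic vector [e].
    On a nondegenerate hyperplane the statement fails, because the reflection
    in a nonzero vector orthogonal to [E] fixes [E] pointwise; isotropy of [e]
    is what rules this reflection out. *)
Lemma isometry_fixing_degenerate_hyperplane e z (f : 'End(V)) :
    nondegenerate B -> (E + <[z]>)%VS = fullv ->
    e \in E -> e \in orthov B E -> B e z = 1 ->
    (forall u v, B (f u) (f v) = B u v) -> {in E, forall v, f v = v} ->
  f = \1%VF.
Proof.
move=> ndB Ez eE /mem_orthovP eo Bez fB fE.
pose d := f z - z.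
have dE v : v \in E -> B d v = 0.
  by move=> vE; rewrite linearBl /= -{1}(fE v vE) fB subrr.
have d_line : d = B d z *: e.
  apply/eqP; rewrite -subr_eq0 -memv0 -(eqP ndB); apply/mem_orthovP => v.
  rewrite -Ez => /memv_addP[u uE [_ /vlineP[k ->] ->]].
  by rewrite linearBl linearZl_LR !linearDr !linearZr_LR /= dE // eo // Bez; ring.
(* [f z = z + c e] has squared length [B z z + 2 c], where [c = B d z]. *)
have Bdz : B d z = 0.
  have Bzd : B z d = B d z by exact: symmetricC.
  have Bdd : B d d = 0 by rewrite {2}d_line linearZr_LR /= (dE e eE) mulr0.
  have : B (z + d) (z + d) = B z z by rewrite /d addrC subrK fB.
  by rewrite linearDl /= [B z (z + d)]linearDr [B d (z + d)]linearDr /= Bzd Bdd; lra.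
have fz : f z = z by apply/eqP; rewrite -subr_eq0 -/d d_line Bdz scale0r.
apply/lfunP => v; rewrite id_lfunE.
have : v \in (E + <[z]>)%VS by rewrite Ez memvf.
move=> /memv_addP[u uE [_ /vlineP[k ->] ->]].
by rewrite linearD linearZ /= fz fE.
Qed.

(** Injectivity of a map that is multiplicative only on a set of isometries is
    reduced to the triviality of its kernel through [f^-1 \o g]. *)
Lemma restriction_injective e z :
    nondegenerate B -> (E + <[z]>)%VS = fullv ->
    e \in E -> e \in orthov B E -> B e z = 1 ->
  {in stabilizing_isometries &, injective restriction}.
Proof.
move=> ndB Ez eE eo Bez f g /set_mem Sf /set_mem Sg fg.
have [_ SM SV] := linear_group_stabilizing_isometries.
have [fB fE kf] := Sf; have [gB gE kg] := Sg.
have [_ SVf] := SV f Sf; have [VgB _ _] := SM _ _ SVf Sg.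
suff Vfg : (f^-1 \o g = \1)%VF.
  by rewrite -[LHS]comp_lfun1r -Vfg lker0_compVKf.
apply: isometry_fixing_degenerate_hyperplane ndB Ez eE eo Bez VgB _ => v vE.
rewrite comp_lfunE -[v in g v](vsprojK vE) -restrictionE // -fg restrictionE //.
by rewrite vsprojK // lker0_lfunK.
Qed.

(** Restricting a reflection group to a degenerate hyperplane that contains
    all the roots loses nothing. *)
Lemma isomorphic_systems_restriction (I : Type) (x : I -> V) e z :
    nondegenerate B -> (E + <[z]>)%VS = fullv ->
    e \in E -> e \in orthov B E -> B e z = 1 -> (forall i, x i \in E) ->
  let S := range (fun i => reflection B (x i)) in
  let SE := range (fun i => reflection
    (fun u v : subvs_of E => B (vsval u) (vsval v)) (vsproj E (x i))) in
  isomorphic_systems (generated_group SE) SE (generated_group S) S.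
Proof.
move=> ndB Ez eE eo Bez xE S SE.
have -> : SE = restriction @` S.
  rewrite /S image_comp; apply: eq_imagel => i _ /=.
  by rewrite restriction_reflection.
apply: isomorphic_systems_image linear_group_stabilizing_isometries _
  restriction1 restrictionM (restriction_injective ndB Ez eE eo Bez).
by move=> _ [i _ <-]; exact: reflection_stabilizing.
Qed.

End Restriction.

(** * The hyperbolic covers *)

Theorem corollary3p11 (R : realType) (V : vectType R) (B : {symmetric V})
  (Phi : set V) (n : nat)
  (hPhi : elliptic B Phi n)
  (hlen : forall x, Phi x -> B x x = 2)
  (U : {vspace V}) (a : V)
  (Vq : vectType R) (pi : 'Hom(V, Vq)) (Bq : {symmetric Vq})
  (beta : 'I_n.+1 -> Vq) (m : 'I_n.+1 -> nat) (alpha : 'I_n.+1 -> V)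
  (hchoice : affine_basis_choice B Phi U a pi Bq beta m alpha)
  (t : 'I_n.+1) (ht : tubular m t)
  (W S : set 'End(V))
  (hWS : tubular_elliptic_Weyl_system alpha a t B Phi W S)
  (Vh : vectType R) (iota : 'Hom(V, Vh)) (Bh : {symmetric Vh}) (a' b' : Vh)
  (hyp : hyperbolic_extension alpha m a B iota Bh a' b') :
  isomorphic_systems
    (Wtilde alpha a t iota Bh b') (Stilde alpha a t iota Bh b')
    (What alpha a t iota Bh) (Shat alpha a t iota Bh).
Proof.
have aU : a \in U.
  have : Zspan [set a] a.
    exists 1%N, (fun=> a), (fun=> 1); split=> //.
    by rewrite big_ord1 mulr1z.
  by rewrite -(choice_a hchoice) => -[].
have aB v : B a v = 0.
  have /subvP/(_ a aU)/mem_orthovP := choice_U_rad hchoice.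
  by apply; exact: memvf.
have [_ _ Baa'] := hyp_pair_a hyp.
have VE v : iota v \in Vtilde iota b'.
  by apply: (subvP (addvSl _ _)); exact: memv_img (memvf v).
apply: (@isomorphic_systems_restriction _ _ Bh (Vtilde iota b') _
  (fun i => iota (extended_root alpha a t i)) (iota a) a') => //.
- exact: hyp_nondegenerate hyp.
- have b'E : b' \in Vtilde iota b' by exact: (subvP (addvSr _ _) _ (memv_line _)).
  have /subvP E_sub := addvSl (Vtilde iota b') <[a']>%VS.
  have a'_sub : a' \in (Vtilde iota b' + <[a']>)%VS.
    exact: (subvP (addvSr _ _) _ (memv_line _)).
  apply/eqP; rewrite eqEsubv subvf -(hyp_full hyp) !subv_add /=.
  apply/andP; split; first (apply/andP; split).
  + by apply/subvP => _ /memv_imgP[v _ ->]; exact: E_sub.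
  + by apply/span_subvP => v; rewrite !inE => /orP[] /eqP-> //; exact: E_sub.
  + by apply/span_subvP => v; rewrite !inE => /orP[] /eqP->; exact: E_sub.
- apply/mem_orthovP => _ /memv_addP[_ /memv_imgP[v _ ->] [_ /vlineP[k ->] ->]].
  rewrite linearDr linearZr_LR /= (hyp_isometry hyp) aB.
  have /orthovP -> := hyp_orth_ab hyp; first by rewrite mulr0 addr0.
  + by apply: memv_span; rewrite mem_head.
  + by apply: memv_span; rewrite !inE eqxx orbT.
Qed.
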